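(* Let $\mathbb F$ be a field of characteristic $0$, let $r\in\mathcal R_{\mathbb F}(\underline z)$ be a noncommutative rational expression in $z_1,\dots,z_g$ and let $\underline p=(p_1,\dots,p_g)\in\operatorname{dom}_mr$. If $\mathcal A\subseteq M_m(\mathbb F)$ is the unital $\mathbb F$-algebra generated by $p_1,\dots,p_g$, then there exist $n\in\mathbb N$, $\mathbf c\in\mathcal A^{1\times n}$, $\mathbf b\in\mathcal A^{n\times1}$ and $A^{x_j}\in(\mathcal A^{x_j})^{n\times n}$ for $1\le j\le g$ such that $$r(\underline x+\underline p)=\mathbf c\left(I_n-\sum_{j=1}^gA^{x_j}\right)^{-1}\mathbf b .$$
   Context: $\mathcal R_{\mathbb F}(\underline z)$ is the set of syntactically valid combinations of noncommutative polynomials over $\mathbb F$ in $\underline z=\{z_1,\dots,z_g\}$, operations $+,\cdot,{}^{-1}$ and parentheses. For $\underline a\in M_m(\mathbb F)^g$, $r(\underline a)$ is obtained by replacing $z_j$ by $a_j$ and $1$ by $I_m$; $\operatorname{dom}_m r\subseteq M_m(\mathbb F)^g$ is the set of $\underline a$ at which all inverses occurring in $r$ exist. $\underline x=\{x_1,\dots,x_g\}$ are freely noncommuting letters. $M_m(\mathbb F)\langle\underline x\rangle=M_m(\mathbb F)*_{\mathbb F}\mathbb F\langle\underline x\rangle$ (free product of unital $\mathbb F$-algebras), and $M_m(\mathbb F)\langle\!\langle\underline x\rangle\!\rangle$ is its $(\underline x)$-adic completion; a series there is invertible iff its constant term is invertible in $M_m(\mathbb F)$. $r(\underline x+\underline p)=r(x_1+p_1,\dots,x_g+p_g)\in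 M_m(\mathbb F)\langle\!\langle\underline x\rangle\!\rangle$ is the expansion of $r$ about $\underline p$, obtained by substituting $x_j+p_j$ for $z_j$ (all required inverses exist since $\underline p\in\operatorname{dom}_mr$). $\mathcal A^{x_j}$ is the $\mathcal A$-bimodule generated by $x_j$, i.e. the $\mathbb F$-span of $\{a\,x_j\,b:a,b\in\mathcal A\}$. *)

(* Defs.v *)
From HB Require Import structures.
From mathcomp Require Import all_boot all_algebra falgebra.
From mathcomp Require Import boolp.
From mathcomp Require Import monalg.

Set Implicit Arguments.
Unset Strict Implicit.
Unset Printing Implicit Defensive.

Import GRing.Theory.
Local Open Scope ring_scope.

(* Formal power series sum_w c_w w in the free monoid on X, with coefficients
   in R commuting with the letters. *)
Record ncseries (X : Type) (R : Type) := NCSeries { coef : seq X -> R }.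

Section Structures.
Variable X : Type.

Lemma ncseriesP (R : Type) (S T : ncseries X R) :
  (forall w, coef S w = coef T w) -> S = T.
Proof. by case: S T => [S] [T] /= eqST; congr NCSeries; apply/funext. Qed.

HB.instance Definition _ (R : Type) := gen_eqMixin (ncseries X R).
HB.instance Definition _ (R : Type) := gen_choiceMixin (ncseries X R).

Section Zmodule.
Variable R : zmodType.
Implicit Types S T : ncseries X R.

Definition nczero : ncseries X R := NCSeries (fun=> 0).
Definition ncopp S := NCSeries (fun w => - coef S w).
Definition ncadd S T := NCSeries (fun w => coef S w + coef T w).

Fact ncaddA : associative ncadd.
Proof. by move=> S T U; apply: ncseriesP => w /=; rewrite addrA. Qed.
Fact ncaddC : commutative ncadd.
Proof. by move=> S T; apply: ncseriesP => w /=; rewrite addrC. Qed.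
Fact ncadd0 : left_id nczero ncadd.
Proof. by move=> S; apply: ncseriesP => w /=; rewrite add0r. Qed.
Fact ncaddN : left_inverse nczero ncopp ncadd.
Proof. by move=> S; apply: ncseriesP => w /=; rewrite addNr. Qed.

HB.instance Definition _ :=
  GRing.isZmodule.Build (ncseries X R) ncaddA ncaddC ncadd0 ncaddN.

Lemma coef0 w : coef (0 : ncseries X R) w = 0. Proof. by []. Qed.
Lemma coefD S T w : coef (S + T) w = coef S w + coef T w. Proof. by []. Qed.
Lemma coefN S w : coef (- S) w = - coef S w. Proof. by []. Qed.
Lemma coefB S T w : coef (S - T) w = coef S w - coef T w. Proof. by []. Qed.

Lemma coef_sum (I : Type) (r : seq I) (P : pred I) (S : I -> ncseries X R) w :
  coef (\sum_(i <- r | P i) S i) w = \sum_(i <- r | P i) coef (S i) w.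
Proof.
by elim/big_ind2: _ => // S1 c1 S2 c2 <- <-.
Qed.
End Zmodule.

Section Ring.
Variable R : nzRingType.
Implicit Types S T : ncseries X R.

Definition ncconst (a : R) : ncseries X R :=
  NCSeries (fun w => if w is [::] then a else 0).

Definition ncmul S T := NCSeries (fun w =>
  \sum_(k < (size w).+1) coef S (take k w) * coef T (drop k w)).

Fact ncmulA : associative ncmul.
Proof.
move=> S T U; apply: ncseriesP => w /=.
transitivity (\sum_(0 <= i < (size w).+1) \sum_(0 <= j < (size w).+1 | (i <= j)%N)
   coef S (take i w) * (coef T (drop i (take j w)) * coef U (drop j w))).
  rewrite big_mkord; apply: eq_bigr => i _; rewrite big_distrr /= size_drop.
  have lei : (i <= size w)%N by rewrite -ltnS.
  rewrite -(big_nat_widenl _ _ _ predT) // -[X in index_iota X _]add0n.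
  rewrite big_addn subSn // big_mkord.
  by apply: eq_bigr => j _; rewrite take_drop drop_drop.
rewrite (exchange_big_dep predT) //= big_mkord; apply: eq_bigr => j _.
have lej : (j <= size w)%N by rewrite -ltnS.
rewrite big_distrl /= size_take_min (minn_idPl lej).
rewrite -(big_nat_widen _ _ _ predT _ (ltn_ord j)) big_mkord.
by apply: eq_bigr => i _; rewrite mulrA take_takel // -ltnS.
Qed.

Fact ncmul1 : left_id (ncconst 1) ncmul.
Proof.
move=> S; apply: ncseriesP => w /=.
rewrite big_ord_recl take0 drop0 mul1r big1 ?addr0 // => i _ /=.
by case: w i => [|x w] [i lti] //=; rewrite mul0r.
Qed.

Fact ncmulr1 : right_id (ncconst 1) ncmul.
Proof.
move=> S; apply: ncseriesP => w /=.
rewrite big_ord_recr /= take_size drop_size mulr1 big1 ?add0r // => i _ /=.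
by case E: (drop i w) (size_drop i w) => [|x v]; rewrite ?mulr0 //=
  => /esym/eqP; rewrite subn_eq0 leqNgt ltn_ord.
Qed.

Fact ncmulDl : left_distributive ncmul +%R.
Proof.
move=> S T U; apply: ncseriesP => w /=; rewrite -big_split /=.
by apply: eq_bigr => k _; rewrite mulrDl.
Qed.

Fact ncmulDr : right_distributive ncmul +%R.
Proof.
move=> S T U; apply: ncseriesP => w /=; rewrite -big_split /=.
by apply: eq_bigr => k _; rewrite mulrDr.
Qed.

Fact ncone_neq0 : ncconst 1 != 0.
Proof.
by apply/eqP => /(congr1 (fun S => coef S [::])) /eqP /=; rewrite oner_eq0.
Qed.

HB.instance Definition _ := GRing.Zmodule_isNzRing.Build (ncseries X R)
  ncmulA ncmul1 ncmulr1 ncmulDl ncmulDr ncone_neq0.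

#[global] Arguments ncmul : simpl never.

Lemma coefM S T w : coef (S * T) w =
  \sum_(k < (size w).+1) coef S (take k w) * coef T (drop k w).
Proof. by []. Qed.

Lemma coefM_nil S T : coef (S * T) [::] = coef S [::] * coef T [::].
Proof. by rewrite coefM big_ord1. Qed.

Lemma coef_constM a S w : coef (ncconst a * S) w = a * coef S w.
Proof.
rewrite coefM big_ord_recl take0 drop0 big1 ?addr0 // => i _ /=.
by case: w i => [|x w] [i lti] //=; rewrite mul0r.
Qed.

Lemma coef_Mconst a S w : coef (S * ncconst a) w = coef S w * a.
Proof.
rewrite coefM big_ord_recr /= take_size drop_size big1 ?add0r // => i _ /=.
by case E: (drop i w) (size_drop i w) => [|x v]; rewrite ?mulr0 //=
  => /esym/eqP; rewrite subn_eq0 leqNgt ltn_ord.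
Qed.

Fact ncconst_is_additive : {morph ncconst : a b / a - b}.
Proof. by move=> a b; apply: ncseriesP => -[|x w] //=; rewrite ?coefB subr0. Qed.
HB.instance Definition _ :=
  GRing.isZmodMorphism.Build R (ncseries X R) ncconst ncconst_is_additive.

Fact ncconst_is_monoid_morphism : monoid_morphism ncconst.
Proof.
split=> // a b; apply: ncseriesP => w; rewrite coef_constM.
by case: w => //= x w; rewrite mulr0.
Qed.
HB.instance Definition _ :=
  GRing.isMonoidMorphism.Build R (ncseries X R) ncconst
    ncconst_is_monoid_morphism.

Lemma coef_exp_small T n w :
  coef T [::] = 0 -> (size w < n)%N -> coef (T ^+ n) w = 0.
Proof.
move=> T0; elim: n w => // n IHn w ltwn; rewrite exprS coefM big1 // => k _.
case: k => [[|k] ltk] /=; first by rewrite take0 T0 mul0r.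
rewrite IHn ?mulr0 //= size_drop ltn_subLR // (leq_trans ltwn) //.
by rewrite addSn ltnS leq_addl.
Qed.
End Ring.

Section UnitRing.
Variable R : unitRingType.
Implicit Types S T : ncseries X R.

Definition ncunit : pred (ncseries X R) :=
  fun S => coef S [::] \is a GRing.unit.

(* With a := coef S [::] and S = a (1 - T), where T has no constant term, the
   inverse is (sum_k T^k) a^-1; only the terms k <= size w contribute at w. *)
Definition ncinv S : ncseries X R :=
  let c := ncconst (coef S [::])^-1 in
  if ncunit S then
    NCSeries (fun w => \sum_(k < (size w).+1) coef ((1 - c * S) ^+ k * c) w)
  else S.

Section Inverse.
Variable S : ncseries X R.
Hypothesis uS : ncunit S.
Let c := ncconst (coef S [::])^-1.
Let T := 1 - c * S.

Let T0 : coef T [::] = 0.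
Proof. by rewrite coefB coef_constM mulVr // subrr. Qed.

Let inv_trunc N w : (size w < N)%N ->
  coef (ncinv S) w = coef ((\sum_(k < N) T ^+ k) * c) w.
Proof.
move=> ltwN; rewrite mulr_suml coef_sum /ncinv uS [LHS]/=.
rewrite (big_ord_widen _ (fun k => coef (T ^+ k * c) w) ltwN) big_mkcond.
apply: eq_bigr => k _; case: ifPn => //; rewrite -leqNgt => ltwk.
by rewrite coef_Mconst coef_exp_small ?mul0r.
Qed.

Let geomE N : (1 - T) * \sum_(k < N) T ^+ k = 1 - T ^+ N.
Proof.
by rewrite -opprB mulNr -subrX1 opprB.
Qed.

Let geomC N : GRing.comm (1 - T) (\sum_(k < N) T ^+ k).
Proof.
apply: commr_sum => k _; apply: commrX; apply: commr_sym.
by apply: commrB => //; apply: commr1.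
Qed.

Let cS : c * S = 1 - T. Proof. by rewrite /T opprB addrCA subrr addr0. Qed.

Let SE : S = ncconst (coef S [::]) * (1 - T).
Proof. by rewrite -cS mulrA -rmorphM mulrV // rmorph1 mul1r. Qed.

Fact ncmulV : S * ncinv S = 1.
Proof.
apply: ncseriesP => w; set N := (size w).+1.
transitivity (coef (S * (\sum_(k < N) T ^+ k * c)) w).
  rewrite !coefM; apply: eq_bigr => k _; congr (_ * _).
  rewrite -mulr_suml; apply: inv_trunc.
  by rewrite ltnS size_drop leq_subr.
rewrite -mulr_suml {1}SE -!mulrA [(1 - T) * _]mulrA geomE.
rewrite mulrBl mul1r mulrBr coefB -rmorphM divrr // rmorph1.
by rewrite coef_constM coef_Mconst coef_exp_small // mul0r mulr0 subr0.
Qed.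

Fact ncVmul : ncinv S * S = 1.
Proof.
apply: ncseriesP => w; set N := (size w).+1.
transitivity (coef ((\sum_(k < N) T ^+ k * c) * S) w).
  rewrite !coefM; apply: eq_bigr => k _; congr (_ * _).
  rewrite -mulr_suml; apply: inv_trunc.
  by rewrite ltnS size_take_min geq_minr.
rewrite -mulr_suml -mulrA cS -geomC geomE coefB.
by rewrite coef_exp_small // subr0.
Qed.
End Inverse.

Fact ncunitP S T : T * S = 1 /\ S * T = 1 -> ncunit S.
Proof.
move=> [/(congr1 (fun U => coef U [::])) TS /(congr1 (fun U => coef U [::])) ST].
by apply/unitrP; exists (coef T [::]); rewrite -!coefM_nil.
Qed.

Fact ncinv_out : {in [predC ncunit], ncinv =1 id}.
Proof. by move=> S uS; rewrite /ncinv (negbTE uS : ncunit S = false). Qed.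

HB.instance Definition _ := GRing.NzRing_hasMulInverse.Build (ncseries X R)
  ncVmul ncmulV ncunitP ncinv_out.

Lemma ncseries_unitE S :
  (S \is a GRing.unit) = (coef S [::] \is a GRing.unit).
Proof. by []. Qed.
End UnitRing.

Section Algebra.
Variables (F : nzRingType) (R : algType F).
Implicit Types S T : ncseries X R.

Definition ncscale (a : F) S := NCSeries (fun w => a *: coef S w).

Fact ncscaleA a b S : ncscale a (ncscale b S) = ncscale (a * b) S.
Proof. by apply: ncseriesP => w /=; rewrite scalerA. Qed.
Fact ncscale1 : left_id 1 ncscale.
Proof. by move=> S; apply: ncseriesP => w /=; rewrite scale1r. Qed.
Fact ncscaleDr : right_distributive ncscale +%R.
Proof. by move=> a S T; apply: ncseriesP => w /=; rewrite scalerDr. Qed.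
Fact ncscaleDl S : {morph ncscale^~ S : a b / a + b}.
Proof. by move=> a b; apply: ncseriesP => w /=; rewrite scalerDl. Qed.

HB.instance Definition _ := GRing.Zmodule_isLmodule.Build F (ncseries X R)
  ncscaleA ncscale1 ncscaleDr ncscaleDl.

Lemma coefZ a S w : coef (a *: S) w = a *: coef S w. Proof. by []. Qed.

Fact ncscaleAl (a : F) S T : a *: (S * T) = (a *: S) * T.
Proof.
apply: ncseriesP => w; rewrite coefZ !coefM scaler_sumr.
by apply: eq_bigr => k _; rewrite scalerAl.
Qed.
HB.instance Definition _ :=
  GRing.Lmodule_isLalgebra.Build F (ncseries X R) ncscaleAl.

Fact ncscaleAr (a : F) S T : a *: (S * T) = S * (a *: T).
Proof.
apply: ncseriesP => w; rewrite coefZ !coefM scaler_sumr.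
by apply: eq_bigr => k _; rewrite scalerAr.
Qed.
HB.instance Definition _ :=
  GRing.Lalgebra_isAlgebra.Build F (ncseries X R) ncscaleAr.

Fact ncconst_is_scalable : scalable (@ncconst R : R -> ncseries X R).
Proof. by move=> a b; apply: ncseriesP => -[|x w] //=; rewrite scaler0. Qed.
HB.instance Definition _ :=
  GRing.isScalable.Build F R (ncseries X R) *:%R (@ncconst R)
    ncconst_is_scalable.
End Algebra.

HB.instance Definition _ (F : nzRingType) (R : unitAlgType F) :=
  GRing.Algebra.on (ncseries X R).
End Structures.

#[global] Arguments coef : simpl never.
#[global] Arguments ncconst {X R} a.

(* The free product M_{m+1}(F) * F<x_1..x_g> has the F-basis
     E_{i j_0} x_{k_1} E_{i_1 j_1} x_{k_2} ... x_{k_d} E_{i_d j},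
   E_{i j} the matrix units. Reading (j_{t-1}, k_t, i_t) as a letter, a series
   of the completion is a function S from words in these letters to matrices,
   where S u i j is the coefficient of the basis element above, for
   u = (j_0, k_1, i_1) ... (j_{d-1}, k_d, i_d). As
   E_{i_d j} E_{i' j'} = [j = i'] E_{i_d j'}, the product is the Cauchy product
   of ncseries. The free product itself is gpoly, the subalgebra of series of
   bounded degree; gpoly_free_product is its universal property. *)
Notation gletter g m := ('I_m.+1 * 'I_g * 'I_m.+1)%type.
Notation gseries F g m := (ncseries (gletter g m) 'M[F]_m.+1).

(* x_k = sum_(i, j) E_{i i} x_k E_{j j} *)
Definition gvar (F : fieldType) (g m : nat) (k : 'I_g) : gseries F g m :=
  NCSeries (fun u : seq (gletter g m) => if u is [:: (i, l, j)]
                     then if l == k then delta_mx i j else 0 else 0).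

Section FreeProduct.
Variables (F : fieldType) (g m : nat).
Local Notation ser := (gseries F g m).
Local Notation X := (gletter g m).
Local Notation M := 'M[F]_m.+1.

Definition gpoly : {pred ser} :=
  [pred S | `[< exists d, forall u, (d <= size u)%N -> coef S u = 0 >]].

Lemma gpolyP S :
  reflect (exists d, forall u, (d <= size u)%N -> coef S u = 0) (S \in gpoly).
Proof. exact: asboolP. Qed.

Lemma gpoly_const a : ncconst a \in gpoly.
Proof. by apply/gpolyP; exists 1%N => -[|x u]. Qed.

Lemma gpoly_var k : gvar F m k \in gpoly.
Proof. by apply/gpolyP; exists 2%N => -[|[[? ?] ?] [|? ?]]. Qed.

Lemma gpoly_subalg : subalg_closed gpoly.
Proof.
split.
- exact: gpoly_const.
- move=> a S T /gpolyP[d Sd] /gpolyP[e Te]; apply/gpolyP; exists (maxn d e) => u.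
  by rewrite geq_max => /andP[/Sd Su /Te Tu]; rewrite coefD coefZ Su Tu scaler0 addr0.
- move=> S T /gpolyP[d Sd] /gpolyP[e Te]; apply/gpolyP; exists (d + e)%N => u ltu.
  rewrite coefM big1 // => k _; have lek : (k <= size u)%N by rewrite -ltnS.
  have [ledk|ltkd] := leqP d k.
    by rewrite Sd ?mul0r // size_take_min (minn_idPl lek).
  rewrite Te ?mulr0 // size_drop leq_subRL //.
  by apply: leq_trans ltu; rewrite leq_add2r ltnW.
Qed.

(* psi restricts on gpoly to an algebra morphism extending phi and b; its values
   off gpoly are irrelevant. *)
Definition gpoly_hom (B : algType F) (phi : M -> B) (b : 'I_g -> B)
    (psi : ser -> B) : Prop :=
  [/\ forall c, {in gpoly &, forall S T, psi (c *: S + T) = c *: psi S + psi T},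
      {in gpoly &, {morph psi : S T / S * T}},
      forall a, psi (ncconst a) = phi a &
      forall k, psi (gvar F m k) = b k].

Definition gmono (u : seq X) (a : M) : ser :=
  NCSeries (fun v => if v == u then a else 0).

Lemma coef_gmono u a v : coef (gmono u a) v = if v == u then a else 0.
Proof. by []. Qed.

Lemma coef_const a u :
  coef (ncconst a : ser) u = if u is [::] then a else 0.
Proof. by []. Qed.

Lemma gmono_nil a : gmono [::] a = ncconst a.
Proof. by apply: ncseriesP => -[|x u]. Qed.

Lemma gmonoM u v a c : gmono u a * gmono v c = gmono (u ++ v) (a * c).
Proof.
apply: ncseriesP => w; rewrite coefM coef_gmono.
have [->|neq] := eqVneq w (u ++ v).
  have ltu : (size u < (size (u ++ v)).+1)%N by rewrite size_cat ltnS leq_addr.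
  rewrite (bigD1 (Ordinal ltu)) //= !coef_gmono take_size_cat // drop_size_cat //.
  rewrite !eqxx big1 ?addr0 // => k nek; rewrite !coef_gmono.
  case: eqP => [eqk|_]; last by rewrite mul0r.
  case/eqP: nek; apply: val_inj => /=.
  have lek : (k <= size (u ++ v))%N by rewrite -ltnS.
  by move/(congr1 size): eqk; rewrite size_take_min (minn_idPl lek).
rewrite big1 // => k _; rewrite !coef_gmono.
case: eqP => [eu|_]; last by rewrite mul0r.
case: eqP => [ev|_]; last by rewrite mulr0.
by case/eqP: neq; rewrite -eu -ev cat_take_drop.
Qed.

Lemma gpoly_mono u a : gmono u a \in gpoly.
Proof.
apply/gpolyP; exists (size u).+1 => v; rewrite coef_gmono.
by case: eqP => // ->; rewrite ltnn.
Qed.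

Lemma gvarE k : gvar F m k = \sum_i \sum_j gmono [:: (i, k, j)] (delta_mx i j).
Proof.
apply: ncseriesP => u; rewrite coef_sum.
have -> : coef (gvar F m k) u = if u is [:: (i, l, j)]
  then if l == k then delta_mx i j else 0 else 0 by [].
under eq_bigr do rewrite coef_sum; under eq_bigr do under eq_bigr do
  rewrite coef_gmono.
case: u => [|[[i l] j] [|y u]].
- by rewrite big1 // => i _; rewrite big1.
- rewrite (bigD1 i) //= (bigD1 j) //= eqseq_cons !xpair_eqE !eqxx !andbT /=.
  rewrite big1 ?addr0 => [|j' nej]; last first.
    by rewrite eqseq_cons !xpair_eqE (eq_sym j) (negbTE nej) !andbF.
  rewrite big1 ?addr0 // => i' nei; rewrite big1 // => j' _.
  by rewrite eqseq_cons !xpair_eqE (eq_sym i) (negbTE nei).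
- by rewrite big1 // => i' _; rewrite big1 // => j' _; rewrite eqseq_cons andbF.
Qed.

Lemma gpoly_sum S d : (forall u, (d <= size u)%N -> coef S u = 0) ->
  S = \sum_(n < d) \sum_(t : n.-tuple X) gmono t (coef S t).
Proof.
move=> Sd; apply: ncseriesP => u; rewrite coef_sum.
under eq_bigr do rewrite coef_sum; under eq_bigr do under eq_bigr do
  rewrite coef_gmono.
have [led|ltd] := leqP d (size u).
  rewrite Sd // big1 // => n _; rewrite big1 // => t _; case: eqP => // ut.
  by case/idP: (leq_trans (ltn_ord n) led); rewrite ut size_tuple ltnn.
rewrite (bigD1 (Ordinal ltd)) //= (bigD1 (in_tuple u)) //= eqxx.
rewrite big1 ?addr0 => [|t net]; last first.
  by case: eqP => // ut; case/eqP: net; apply: val_inj.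
rewrite big1 ?addr0 // => n nen; rewrite big1 // => t _; case: eqP => // ut.
by case/eqP: nen; apply: val_inj; rewrite /= ut size_tuple.
Qed.

Fixpoint gmon (i : 'I_m.+1) (u : seq X) (j : 'I_m.+1) : ser :=
  if u is (j0, k, i1) :: u'
  then ncconst (delta_mx i j0) * gvar F m k * gmon i1 u' j
  else ncconst (delta_mx i j).

Lemma gmonE i u j : gmon i u j = gmono u (delta_mx i j).
Proof.
elim: u i => [|[[j0 k] i1] u IHu] i; first by rewrite gmono_nil.
rewrite [LHS]/= IHu gvarE big_distrr big_distrl (bigD1 j0) //=.
rewrite [X in _ + X]big1 ?addr0 => [|i' nei]; last first.
  rewrite big_distrr big_distrl big1 //= => j' _.
  rewrite -gmono_nil !gmonoM -[delta_mx i j0 * _]/(_ *m _).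
  rewrite mul_delta_mx_cond eq_sym (negbTE nei) mulr0n mul0r.
  by apply: ncseriesP => v; rewrite coef_gmono if_same.
rewrite big_distrr big_distrl (bigD1 i1) //= -gmono_nil !gmonoM.
rewrite -[delta_mx i j0 * _]/(_ *m _) mul_delta_mx.
rewrite -[delta_mx i i1 * _]/(_ *m _) mul_delta_mx.
rewrite big1 ?addr0 // => j' nej.
rewrite !gmonoM -[delta_mx i j0 * _]/(_ *m _) mul_delta_mx.
rewrite -[delta_mx i j' * _]/(_ *m _) mul_delta_mx_cond (negbTE nej).
by apply: ncseriesP => v; rewrite coef_gmono if_same.
Qed.

Section Hom.
Variables (B : algType F) (phi : {lrmorphism M -> B}) (b : 'I_g -> B).

Fixpoint gmon_val (i : 'I_m.+1) (u : seq X) (j : 'I_m.+1) : B :=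
  if u is (j0, k, i1) :: u' then phi (delta_mx i j0) * b k * gmon_val i1 u' j
  else phi (delta_mx i j).

Lemma phi_delta i j k v l :
  phi (delta_mx i j) * gmon_val k v l = gmon_val i v l *+ (j == k).
Proof.
case: v => [|[[j0 k0] i1] v] /=; rewrite ?mulrA -rmorphM /=.
  by rewrite -[_ * _]/(_ *m _) mul_delta_mx_cond raddfMn.
by rewrite -[delta_mx _ _ * _]/(_ *m _) mul_delta_mx_cond raddfMn !mulrnAl.
Qed.

Lemma gmon_valM i u j k v l :
  gmon_val i u j * gmon_val k v l = gmon_val i (u ++ v) l *+ (j == k).
Proof.
elim: u i => [|[[j0 k0] i1] u IHu] i /=; first exact: phi_delta.
by rewrite -mulrA IHu mulrnAr.
Qed.

Definition gmono_val u (a : M) : B := \sum_i \sum_j a i j *: gmon_val i u j.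

Lemma gmono_val_lin u c a a' :
  gmono_val u (c *: a + a') = c *: gmono_val u a + gmono_val u a'.
Proof.
rewrite scaler_sumr -big_split /=; apply: eq_bigr => i _.
rewrite scaler_sumr -big_split /=; apply: eq_bigr => j _.
by rewrite !mxE scalerDl scalerA.
Qed.

HB.instance Definition _ u :=
  GRing.isLinear.Build F M B *:%R (gmono_val u) (gmono_val_lin u).

Lemma gmono_valM u v a c :
  gmono_val u a * gmono_val v c = gmono_val (u ++ v) (a * c).
Proof.
rewrite /gmono_val big_distrl /=; apply: eq_bigr => i _.
transitivity (\sum_j \sum_l (a i j * c j l) *: gmon_val i (u ++ v) l).
  rewrite big_distrl /=; apply: eq_bigr => j _.
  rewrite big_distrr /= (bigD1 j) //= big_distrr /= [X in _ + X]big1 ?addr0.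
    apply: eq_bigr => l _.
    by rewrite -scalerAl -scalerAr scalerA gmon_valM eqxx.
  move=> k nek; rewrite big_distrr big1 //= => l _.
  by rewrite -scalerAl -scalerAr gmon_valM eq_sym (negbTE nek) mulr0n !scaler0.
rewrite exchange_big /=; apply: eq_bigr => l _.
by rewrite -scaler_suml !mxE.
Qed.

Definition gval_trunc d (S : ser) : B :=
  \sum_(n < d) \sum_(t : n.-tuple X) gmono_val t (coef S t).

Lemma gval_trunc_lin d c S T :
  gval_trunc d (c *: S + T) = c *: gval_trunc d S + gval_trunc d T.
Proof.
rewrite scaler_sumr -big_split /=; apply: eq_bigr => n _.
rewrite scaler_sumr -big_split /=; apply: eq_bigr => t _.
by rewrite coefD coefZ linearP.
Qed.

HB.instance Definition _ d :=
  GRing.isLinear.Build F ser B *:%R (gval_trunc d) (gval_trunc_lin d).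

Lemma gval_trunc_widen d e S : (d <= e)%N ->
  (forall u, (d <= size u)%N -> coef S u = 0) ->
  gval_trunc e S = gval_trunc d S.
Proof.
move=> lede Sd; rewrite /gval_trunc.
rewrite (big_ord_widen _ (fun n => \sum_(t : n.-tuple X) gmono_val t (coef S t)) lede).
rewrite [RHS]big_mkcond; apply: eq_bigr => n _; case: ifPn => //.
rewrite -leqNgt => ledn; rewrite big1 // => t _.
by rewrite Sd ?size_tuple // linear0.
Qed.

Lemma gval_trunc_mono d u a : (size u < d)%N ->
  gval_trunc d (gmono u a) = gmono_val u a.
Proof.
move=> ltd; rewrite /gval_trunc (bigD1 (Ordinal ltd)) //= (bigD1 (in_tuple u)) //=.
rewrite coef_gmono eqxx big1 ?addr0 => [|t net]; last first.
  rewrite coef_gmono; case: eqP => [ut|]; last by rewrite linear0.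
  by case/eqP: net; apply: val_inj.
rewrite big1 ?addr0 // => n nen; rewrite big1 // => t _.
rewrite coef_gmono; case: eqP => [ut|]; last by rewrite linear0.
by case/eqP: nen; apply: val_inj; rewrite /= -ut size_tuple.
Qed.

Lemma gval_truncM d e S T :
  (forall u, (d <= size u)%N -> coef S u = 0) ->
  (forall u, (e <= size u)%N -> coef T u = 0) ->
  gval_trunc (d + e) (S * T) = gval_trunc d S * gval_trunc e T.
Proof.
move=> Sd Te; rewrite {1}(gpoly_sum Sd) {1}(gpoly_sum Te) /(gval_trunc d).
rewrite !big_distrl linear_sum /=; apply: eq_bigr => n _.
rewrite !big_distrl linear_sum /=; apply: eq_bigr => t _.
rewrite !big_distrr linear_sum /=; apply: eq_bigr => n' _.
rewrite !big_distrr linear_sum /=; apply: eq_bigr => t' _.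
rewrite gmonoM gmono_valM gval_trunc_mono //.
by rewrite size_cat !size_tuple -addSn leq_add // ltnW.
Qed.

Theorem gpoly_free_product : exists psi : ser -> B, gpoly_hom phi b psi /\
  forall psi', gpoly_hom phi b psi' -> {in gpoly, psi' =1 psi}.
Proof.
pose deg (S : ser) := if pselect (exists d, forall u, (d <= size u)%N -> coef S u = 0)
  is left exd then sval (cid exd) else 0%N.
pose psi (S : ser) := gval_trunc (deg S) S.
have degP S : S \in gpoly -> forall u, (deg S <= size u)%N -> coef S u = 0.
  by move=> /gpolyP ?; rewrite /deg; case: pselect => // ?; case: cid.
have psiE d S : (forall u, (d <= size u)%N -> coef S u = 0) ->
    psi S = gval_trunc d S.
  move=> Sd; have /degP SD : S \in gpoly by apply/gpolyP; exists d.
  by rewrite /psi -(gval_trunc_widen (leq_maxl _ d) SD)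
     (gval_trunc_widen (leq_maxr _ d) Sd).
have psi_mono u a : psi (gmono u a) = gmono_val u a.
  rewrite (psiE (size u).+1) ?gval_trunc_mono // => v.
  by rewrite coef_gmono; case: eqP => // ->; rewrite ltnn.
have psi_lin c : {in gpoly &, forall S T, psi (c *: S + T) = c *: psi S + psi T}.
  move=> S T /degP SD /degP TD; pose d := maxn (deg S) (deg T).
  have Sd u : (d <= size u)%N -> coef S u = 0.
    by rewrite geq_max => /andP[/SD].
  have Td u : (d <= size u)%N -> coef T u = 0.
    by rewrite geq_max => /andP[_ /TD].
  rewrite (psiE d S) // (psiE d T) // (psiE d) ?linearP // => u ltu.
  by rewrite coefD coefZ Sd // Td // scaler0 addr0.
have [gpoly1 gpolyL gpolyM] := gpoly_subalg.
have gpoly0 : 0 \in gpoly by rewrite -(rmorph0 (@ncconst X M)) gpoly_const.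
have gpolyZ c S : S \in gpoly -> c *: S \in gpoly.
  by move=> Sp; rewrite -[_ *: _]addr0 gpolyL.
have gpolyD S T : S \in gpoly -> T \in gpoly -> S + T \in gpoly.
  by move=> Sp Tp; rewrite -[S]scale1r gpolyL.
have homsum psi' : gpoly_hom phi b psi' ->
  [/\ forall c S, S \in gpoly -> psi' (c *: S) = c *: psi' S
    & forall (I : finType) (f : I -> ser), (forall i, f i \in gpoly) ->
      (\sum_i f i \in gpoly) /\ psi' (\sum_i f i) = \sum_i psi' (f i)].
  move=> [lin' _ _ _].
  have psi0 : psi' 0 = 0.
    by have := lin' (-1) 0 0 gpoly0 gpoly0; rewrite scaler0 addr0 scaleN1r addNr.
  split=> [c S Sp|I f fp].
    by rewrite -[c *: S]addr0 lin' // psi0 addr0.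
  suff: forall r : seq I, \sum_(i <- r) f i \in gpoly /\
     psi' (\sum_(i <- r) f i) = \sum_(i <- r) psi' (f i) by apply.
  elim=> [|i r [IHp IH]]; first by rewrite !big_nil.
  rewrite !big_cons gpolyD //; split=> //.
  by rewrite -[f i]scale1r lin' // IH !scale1r.
have psi_hom : gpoly_hom phi b psi.
  split=> //.
  - move=> S T /[dup] Sp /degP SD /[dup] Tp /degP TD.
    rewrite (psiE (deg S + deg T)%N) ?gval_truncM // => u ltu.
    rewrite coefM big1 // => k _; have lek : (k <= size u)%N by rewrite -ltnS.
    have [ledk|ltkd] := leqP (deg S) k.
      by rewrite SD ?mul0r // size_take_min (minn_idPl lek).
    rewrite TD ?mulr0 // size_drop leq_subRL //.
    by apply: leq_trans ltu; rewrite leq_add2r ltnW.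
  - move=> a; rewrite -gmono_nil psi_mono {2}[a]matrix_sum_delta linear_sum.
    by apply: eq_bigr => i _; rewrite linear_sum; apply: eq_bigr => j _; rewrite linearZ.
  - move=> k; rewrite (psiE 2%N); last by move=> [|[[? ?] ?] [|? ?]].
    rewrite gvarE linear_sum /=.
    transitivity (\sum_i \sum_j phi (delta_mx i i) * b k * phi (delta_mx j j)).
      apply: eq_bigr => i _; rewrite linear_sum; apply: eq_bigr => j _ /=.
      rewrite gval_trunc_mono // /gmono_val (bigD1 i) //= (bigD1 j) //=.
      rewrite mxE !eqxx scale1r big1 ?addr0 => [|j' nej]; last first.
        by rewrite mxE (negbTE nej) andbF scale0r.
      rewrite big1 ?addr0 // => i' nei; rewrite big1 // => j' _.
      by rewrite mxE (negbTE nei) scale0r.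
    have sum1 : \sum_i phi (delta_mx i i) = 1.
      rewrite -linear_sum -(rmorph1 phi); congr (phi _).
      apply/matrixP => i j; rewrite summxE mxE (bigD1 i) //= mxE eqxx /=.
      rewrite big1 ?addr0 1?eq_sym // => k' nek.
      by rewrite mxE [i == _]eq_sym (negbTE nek).
    under eq_bigr do rewrite -big_distrr /= sum1 mulr1.
    by rewrite -big_distrl /= sum1 mul1r.
exists psi; split=> // psi' hom'.
have [_ psiM psiC psiX] := psi_hom; have [_ psiM' psiC' psiX'] := hom'.
have [psiZ psiS] := homsum _ psi_hom; have [psiZ' psiS'] := homsum _ hom'.
have gmon_eq i u j : psi' (gmon i u j) = psi (gmon i u j).
  elim: u i => [|[[j0 k] i1] u IHu] i; first by rewrite /= psiC psiC'.
  have ? : gmon i1 u j \in gpoly by rewrite gmonE gpoly_mono.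
  rewrite [gmon _ _ _]/= psiM' ?psiM ?gpolyM ?gpoly_const ?gpoly_var //.
  by rewrite psiM' ?psiM ?gpoly_const ?gpoly_var // psiC psiX psiC' psiX' IHu.
have mono_eq u a : psi' (gmono u a) = psi (gmono u a).
  have -> : gmono u a = \sum_i \sum_j a i j *: gmon i u j.
    apply: ncseriesP => v; rewrite coef_sum coef_gmono.
    under eq_bigr do rewrite coef_sum.
    under eq_bigr do under eq_bigr do rewrite coefZ gmonE coef_gmono.
    case: eqP => _; first exact: matrix_sum_delta.
    by rewrite big1 // => i _; rewrite big1 // => j _; rewrite scaler0.
  have gm i j : gmon i u j \in gpoly by rewrite gmonE gpoly_mono.
  have gZ i j : a i j *: gmon i u j \in gpoly by apply: gpolyZ.
  have gS i := psiS _ _ (gZ i); have gS' i := psiS' _ _ (gZ i).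
  rewrite (psiS' _ _ (fun i => (gS i).1)).2 (psiS _ _ (fun i => (gS i).1)).2.
  apply: eq_bigr => i _; rewrite (gS i).2 (gS' i).2.
  by apply: eq_bigr => j _; rewrite psiZ // psiZ' // gmon_eq.
move=> S /gpolyP[d /gpoly_sum ->].
have gS n := psiS _ _ (fun t : n.-tuple X => gpoly_mono t (coef S t)).
have gS' n := psiS' _ _ (fun t : n.-tuple X => gpoly_mono t (coef S t)).
rewrite (psiS' _ _ (fun n : 'I_d => (gS n).1)).2.
rewrite (psiS _ _ (fun n : 'I_d => (gS n).1)).2.
apply: eq_bigr => n _; rewrite (gS n).2 (gS' n).2.
by apply: eq_bigr => t _; rewrite mono_eq.
Qed.
End Hom.
End FreeProduct.

(* Only inverses restrict the domain of an expression; RPoly leaves are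
   elements of the free algebra F<z_1..z_g>. *)
Inductive ratexpr (F : fieldType) (g : nat) : Type :=
  | RPoly of {malg F[{fmonom 'I_g}]}
  | RAdd of ratexpr F g & ratexpr F g
  | RMul of ratexpr F g & ratexpr F g
  | RInv of ratexpr F g.

Section Evaluation.
Variables (F : fieldType) (g : nat) (B : unitAlgType F) (a : 'I_g -> B).

Definition poly_eval (P : {malg F[{fmonom 'I_g}]}) : B :=
  mmap (in_alg B) (fun w : {fmonom 'I_g} => \prod_(i <- w) a i) P.

Fixpoint rat_eval (r : ratexpr F g) : B :=
  match r with
  | RPoly P => poly_eval P
  | RAdd r1 r2 => rat_eval r1 + rat_eval r2
  | RMul r1 r2 => rat_eval r1 * rat_eval r2
  | RInv r1 => (rat_eval r1)^-1
  end.

(* The inverse of B is total; its values at nonunits are junk unless all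
   inverses occurring in r exist, which is what this asserts. *)
Fixpoint rat_defined (r : ratexpr F g) : bool :=
  match r with
  | RPoly _ => true
  | RAdd r1 r2 | RMul r1 r2 => rat_defined r1 && rat_defined r2
  | RInv r1 => rat_defined r1 && (rat_eval r1 \is a GRing.unit)
  end.
End Evaluation.

Section Expansion.
Variables (F : fieldType) (g m : nat).

Definition rat_dom (r : ratexpr F g) : {pred 'I_g -> 'M[F]_m.+1} :=
  fun p => rat_defined p r.

Definition shifted_var (p : 'I_g -> 'M[F]_m.+1) (j : 'I_g) : gseries F g m :=
  gvar F m j + ncconst (p j).

Definition rat_expansion (r : ratexpr F g) (p : 'I_g -> 'M[F]_m.+1) :
  gseries F g m := rat_eval (shifted_var p) r.

Lemma rat_expansion_defined (r : ratexpr F g) (p : 'I_g -> 'M[F]_m.+1) :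
  p \in rat_dom r -> rat_defined (shifted_var p) r /\
  coef (rat_expansion r p) [::] = rat_eval p r.
Proof.
rewrite /rat_expansion unfold_in /rat_dom.
elim: r => [P|r1 IH1 r2 IH2|r1 IH1 r2 IH2|r1 IH1] /=.
- move=> _; split=> //; rewrite /poly_eval /mmap coef_sum.
  apply: eq_bigr => w _; rewrite coefM_nil coefZ /=; congr (_ *: _ * _).
  elim: (fmonom_val w) => [|i u IHu]; first by rewrite !big_nil.
  by rewrite !big_cons coefM_nil IHu coefD add0r.
- by move=> /andP[/IH1[-> e1] /IH2[-> e2]]; rewrite coefD e1 e2.
- by move=> /andP[/IH1[-> e1] /IH2[-> e2]]; rewrite coefM_nil e1 e2.
- move=> /andP[/IH1[-> e1] u1]; rewrite ncseries_unitE e1 u1; split=> //.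
  apply: (mulrI u1); rewrite divrr // -e1 -coefM_nil divrr //.
  by rewrite ncseries_unitE e1.
Qed.

(* The A-bimodule generated by x_j. *)
Definition in_bimodule (A : {vspace 'M[F]_m.+1}) (j : 'I_g)
    (S : gseries F g m) : Prop :=
  exists (n : nat) (c : 'I_n -> F) (a b : 'I_n -> 'M[F]_m.+1),
    [/\ forall i, a i \in A, forall i, b i \in A &
      S = \sum_i c i *: (ncconst (a i) * gvar F m j * ncconst (b i))].

Definition gen_alg (p : 'I_g -> 'M[F]_m.+1) : {vspace 'M[F]_m.+1} :=
  <<1 & codom p>>%VS.
End Expansion.

Definition mx_inverse (R : nzRingType) (n : nat) (M N : 'M[R]_n) : Prop :=
  M *m N = 1%:M /\ N *m M = 1%:M.

(* Main.v *)
From mathcomp Require Import all_boot all_algebra falgebra.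
From mathcomp Require Import boolp monalg.
Require Import Defs.

(** Call a series S realizable over the subalgebra A of matrices when S = c v
    for a vector v of series that solves a system v = b + L v, where c and b
    have entries in A and the entries of L are sums of terms a x_j a' with a, a'
    in A. As L has no constant term, 1 - L is invertible
    ([mx_inverse_1sub]: geometric series), so that v = (1 - L)^-1 b; splitting
    L according to the variables gives the required formula ([realizableP]).

    It remains to see that the expansion of r is realizable, by induction on r.
    Constants of A, and linear series such as the x_j, are realizable, hence so
    is each x_j + p_j, since p_j is in A. Realizable series are closed under
    sums (take both systems side by side), products ([realizableM]) and inverses
    ([realizableV]). In the last two cases the obvious systems have coefficients
    with a constant term; they become linear when the unknown v is replaced by
    its part L v. The inverse also requires that the constant term c b of S be
    invertible within A: this holds because A has finite dimension, and it is
    the reason why the realization of r has its coefficients in A rather than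
    in the whole matrix algebra. *)

Import GRing.Theory.
Local Open Scope ring_scope.

Set Implicit Arguments.
Unset Strict Implicit.

(** * Coefficients of matrix products of series *)

Section SeriesMatrix.
Variables (X : Type) (R : nzRingType).

(** This allows a series to be replaced by a truncation when one coefficient of
    a product is computed. *)
Lemma eq_coef_mulmx (n1 n2 n3 : nat) (P P' : 'M[ncseries X R]_(n1, n2))
    (Q Q' : 'M[ncseries X R]_(n2, n3)) (w : seq X) :
  (forall i j v, (size v <= size w)%N -> coef (P i j) v = coef (P' i j) v) ->
  (forall i j v, (size v <= size w)%N -> coef (Q i j) v = coef (Q' i j) v) ->
  forall i j, coef ((P *m Q) i j) w = coef ((P' *m Q') i j) w.
Proof.
move=> eqP eqQ i j; rewrite !mxE !coef_sum; apply: eq_bigr => l _.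
rewrite !coefM; apply: eq_bigr => k _; rewrite eqP ?eqQ //.
  by rewrite size_drop leq_subr.
by rewrite size_take_min geq_minr.
Qed.

Lemma coef_mulmx_nil (n1 n2 n3 : nat) (P : 'M[ncseries X R]_(n1, n2))
    (Q : 'M[ncseries X R]_(n2, n3)) i j :
  coef ((P *m Q) i j) [::] = \sum_k coef (P i k) [::] * coef (Q k j) [::].
Proof. by rewrite !mxE coef_sum; apply: eq_bigr => k _; rewrite coefM_nil. Qed.

(** Each factor [Q] raises the order of a matrix of series by at least one. *)
Lemma coef_expmx_small (n : nat) (Q : 'M[ncseries X R]_n) (k : nat)
    (w : seq X) :
  (forall i j, coef (Q i j) [::] = 0) -> (size w < k)%N ->
  forall i j, coef ((Q ^+ k) i j) w = 0.
Proof.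
move=> Q0; elim: k w => // k IHk w ltwk i j.
rewrite exprS -[Q * _]/(Q *m _) !mxE coef_sum big1 // => l _.
rewrite coefM big1 // => -[[|d] ltd] _ /=; first by rewrite take0 Q0 mul0r.
rewrite IHk ?mulr0 //= size_drop ltn_subLR // (leq_trans ltwk) //.
by rewrite addSn ltnS leq_addl.
Qed.

(** The inverse is the geometric series of [Q], whose terms of exponent
    greater than [size w] do not contribute to the coefficient at [w]. *)
Lemma mx_inverse_1sub (n : nat) (Q : 'M[ncseries X R]_n) :
  (forall i j, coef (Q i j) [::] = 0) -> exists N, mx_inverse (1%:M - Q) N.
Proof.
move=> Q0; pose geom K : 'M[ncseries X R]_n := \sum_(k < K) Q ^+ k.
pose N : 'M[ncseries X R]_n :=
  \matrix_(i, j) NCSeries (fun w => coef (geom (size w).+1 i j) w).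
have geomP K w : (size w < K)%N ->
    forall i j, coef (N i j) w = coef (geom K i j) w.
  move=> ltwK i j; rewrite mxE [LHS]/coef /geom !summxE !coef_sum.
  rewrite (big_ord_widen _ (fun k => coef ((Q ^+ k) i j) w) ltwK) big_mkcond.
  apply: eq_bigr => k _; case: ifPn => //; rewrite -leqNgt => ltwk.
  by rewrite coef_expmx_small.
have geomE K : (1 - Q) * geom K = 1 - Q ^+ K.
  by rewrite -opprB mulNr -subrX1 opprB.
have geomC K : GRing.comm (1 - Q) (geom K).
  apply: commr_sum => k _; apply: commrX; apply: commr_sym.
  by apply: commrB => //; apply: commr1.
exists N; split; apply/matrixP => i j; apply: ncseriesP => w;
    pose K := (size w).+1.
- transitivity (coef (((1 - Q) * geom K) i j) w).
    by apply: eq_coef_mulmx => // l k v lev; apply: geomP.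
  by rewrite geomE !mxE coefB coef_expmx_small // subr0.
- transitivity (coef ((geom K * (1 - Q)) i j) w).
    by apply: eq_coef_mulmx => // l k v lev; apply: geomP.
  by rewrite -geomC geomE !mxE coefB coef_expmx_small // subr0.
Qed.
End SeriesMatrix.

Section MatrixEntries.
Variables (T : Type) (P : T -> Prop).

Definition mx_all (n1 n2 : nat) (Q : 'M[T]_(n1, n2)) := forall i j, P (Q i j).

Lemma mx_all_row (n n1 n2 : nat) (Q1 : 'M_(n, n1)) (Q2 : 'M_(n, n2)) :
  mx_all Q1 -> mx_all Q2 -> mx_all (row_mx Q1 Q2).
Proof. by move=> P1 P2 i j; rewrite mxE; case: split. Qed.

Lemma mx_all_col (n n1 n2 : nat) (Q1 : 'M_(n1, n)) (Q2 : 'M_(n2, n)) :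
  mx_all Q1 -> mx_all Q2 -> mx_all (col_mx Q1 Q2).
Proof. by move=> P1 P2 i j; rewrite mxE; case: split. Qed.

Lemma mx_all_block (n1 n2 k1 k2 : nat) (Q11 : 'M_(n1, k1)) (Q12 : 'M_(n1, k2))
    (Q21 : 'M_(n2, k1)) (Q22 : 'M_(n2, k2)) :
  mx_all Q11 -> mx_all Q12 -> mx_all Q21 -> mx_all Q22 ->
  mx_all (block_mx Q11 Q12 Q21 Q22).
Proof. by move=> P11 P12 P21 P22; apply: mx_all_col; apply: mx_all_row. Qed.

Lemma mx_all_const (n1 n2 : nat) (a : T) :
  P a -> mx_all (const_mx a : 'M_(n1, n2)).
Proof. by move=> Pa i j; rewrite mxE. Qed.
End MatrixEntries.

Section Realization.
Variables (F : fieldType) (g m : nat) (A : {aspace 'M[F]_m.+1}).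
Local Notation ser := (gseries F g m).
Local Notation "Q ^cst" := (map_mx (@ncconst (gletter g m) 'M[F]_m.+1) Q)
  (at level 2, left associativity, format "Q ^cst").

(** * Linear series *)

Lemma in_bimodule0 j : in_bimodule A j (0 : ser).
Proof.
exists 0%N, (fun=> 0), (fun=> 0), (fun=> 0).
by split=> [[]|[]|] //; rewrite big_ord0.
Qed.

Lemma in_bimoduleD j (S T : ser) :
  in_bimodule A j S -> in_bimodule A j T -> in_bimodule A j (S + T).
Proof.
move=> [n1 [c1 [a1 [b1 [Aa1 Ab1 ->]]]]] [n2 [c2 [a2 [b2 [Aa2 Ab2 ->]]]]].
pose glue T (f1 : 'I_n1 -> T) (f2 : 'I_n2 -> T) (i : 'I_(n1 + n2)) :=
  match split i with inl k => f1 k | inr k => f2 k end.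
exists (n1 + n2)%N, (glue _ c1 c2), (glue _ a1 a2), (glue _ b1 b2).
split=> [i|i|]; rewrite /glue.
- by case: split.
- by case: split.
- rewrite big_split_ord /=; congr (_ + _); apply: eq_bigr => k _.
    by rewrite (unsplitK (inl k)).
  by rewrite (unsplitK (inr k)).
Qed.

Lemma in_bimoduleM j (a b : 'M[F]_m.+1) (S : ser) : a \in A -> b \in A ->
  in_bimodule A j S -> in_bimodule A j (ncconst a * S * ncconst b).
Proof.
move=> Aa Ab [n [c [a1 [b1 [Aa1 Ab1 ->]]]]].
exists n, c, (fun i => a * a1 i), (fun i => b1 i * b).
split=> [i|i|]; try by apply: memvM.
rewrite mulr_sumr mulr_suml; apply: eq_bigr => i _.
by rewrite -scalerAr -scalerAl !rmorphM !mulrA.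
Qed.

Lemma in_bimodule_coef_nil j (S : ser) : in_bimodule A j S -> coef S [::] = 0.
Proof.
move=> [n [c [a [b [_ _ ->]]]]]; rewrite coef_sum big1 // => i _.
by rewrite coefZ !coefM_nil mulr0 mul0r scaler0.
Qed.

Definition linear_series (S : ser) : Prop :=
  exists2 f : 'I_g -> ser, forall j, in_bimodule A j (f j) & S = \sum_j f j.

Lemma linear_series0 : linear_series 0.
Proof. by exists (fun=> 0) => [j|]; rewrite ?big1 //; apply: in_bimodule0. Qed.

Lemma linear_seriesD S T :
  linear_series S -> linear_series T -> linear_series (S + T).
Proof.
move=> [f1 f1P ->] [f2 f2P ->]; exists (fun j => f1 j + f2 j).
  by move=> j; apply: in_bimoduleD.
by rewrite big_split.
Qed.

Lemma linear_series_coef_nil S : linear_series S -> coef S [::] = 0.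
Proof.
move=> [f fP ->]; rewrite coef_sum big1 // => j _.
exact: in_bimodule_coef_nil (fP j).
Qed.

Hypothesis A1 : 1 \in A.

Lemma linear_series_var j : linear_series (gvar F m j).
Proof.
exists (fun k => if k == j then gvar F m j else 0); last first.
  by rewrite -big_mkcond big_pred1_eq.
move=> k; case: eqP => [->|_]; last exact: in_bimodule0.
exists 1%N, (fun=> 1), (fun=> 1), (fun=> 1); split=> //.
by rewrite big_ord1 scale1r rmorph1 mul1r mulr1.
Qed.

Lemma linear_seriesMr S a :
  a \in A -> linear_series S -> linear_series (S * ncconst a).
Proof.
move=> Aa [f fP ->]; exists (fun j => f j * ncconst a).
  by move=> j; rewrite -[f j]mul1r -(rmorph1 ncconst); apply: in_bimoduleM.
by rewrite mulr_suml.
Qed.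

Definition linear_mx n1 n2 := @mx_all ser linear_series n1 n2.
Definition const_in n1 n2 := @mx_all 'M[F]_m.+1 (fun a => a \in A) n1 n2.

Lemma linear_mxM n1 n2 n3 (L : 'M_(n1, n2)) (C : 'M_(n2, n3)) :
  linear_mx L -> const_in C -> linear_mx (L *m C^cst).
Proof.
move=> LL AC i j; rewrite mxE; elim/big_ind: _ => [||k _].
- exact: linear_series0.
- exact: linear_seriesD.
- by rewrite mxE; apply: linear_seriesMr.
Qed.

Lemma const_inM n1 n2 n3 (C : 'M_(n1, n2)) (D : 'M_(n2, n3)) :
  const_in C -> const_in D -> const_in (C *m D).
Proof.
by move=> AC AD i j; rewrite mxE; apply: memv_suml => k _; apply: memvM.
Qed.

Lemma const_inN n1 n2 (C : 'M_(n1, n2)) : const_in C -> const_in (- C).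
Proof. by move=> AC i j; rewrite mxE memvN. Qed.

Lemma const_inB n1 n2 (C D : 'M_(n1, n2)) :
  const_in C -> const_in D -> const_in (C - D).
Proof. by move=> AC AD i j; rewrite !mxE memvB. Qed.

Lemma const_in0 n1 n2 : const_in (0 : 'M_(n1, n2)).
Proof. by apply: mx_all_const; apply: mem0v. Qed.

Lemma const_in_scalar n a : a \in A -> const_in (a%:M : 'M_n).
Proof. by move=> Aa i j; rewrite mxE; case: eqP => _; rewrite ?mem0v. Qed.

Lemma linear_mx0 n1 n2 : linear_mx (0 : 'M_(n1, n2)).
Proof. by apply: mx_all_const; apply: linear_series0. Qed.

(** * Realizations and their closure properties *)

(** Keeping the solution [v] instead of the inverse of [1 - L] reduces each
    closure property below to the verification of a block linear system. *)
Definition realizable (S : ser) : Prop :=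
  exists (n : nat) (c : 'rV['M[F]_m.+1]_n) (b : 'cV['M[F]_m.+1]_n)
         (L : 'M[ser]_n) (v : 'cV[ser]_n),
    [/\ const_in c, const_in b, linear_mx L,
        v = b^cst + L *m v & S%:M = c^cst *m v].

Lemma realizable_const a : a \in A -> realizable (ncconst a).
Proof.
move=> Aa; exists 1%N, a%:M, 1%:M, 0, 1%:M; split.
- exact: const_in_scalar.
- exact: const_in_scalar.
- exact: linear_mx0.
- by rewrite mul0mx addr0 map_scalar_mx rmorph1.
- by rewrite mulmx1 map_scalar_mx.
Qed.

(** The system is [v1 = S v2], [v2 = 1]: the one-line system [v1 = S] has an
    inhomogeneous part which is not constant. *)
Lemma realizable_linear S : linear_series S -> realizable S.
Proof.
move=> LS; exists (1 + 1)%N, (row_mx 1%:M 0), (col_mx 0 1%:M).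
exists (block_mx 0 S%:M 0 0), (col_mx S%:M 1%:M); split.
- by apply: mx_all_row; [apply: const_in_scalar | apply: const_in0].
- by apply: mx_all_col; [apply: const_in0 | apply: const_in_scalar].
- apply: mx_all_block; try exact: linear_mx0.
  by move=> i j; rewrite !ord1 mxE.
- rewrite map_col_mx map_mx0 map_scalar_mx rmorph1 mul_block_col add_col_mx.
  by rewrite !mul0mx mulmx1 !add0r addr0.
- by rewrite map_row_mx map_mx0 map_scalar_mx rmorph1 mul_row_col mul1mx
    mul0mx addr0.
Qed.

Lemma realizableD S T : realizable S -> realizable T -> realizable (S + T).
Proof.
move=> [n1 [c1 [b1 [L1 [v1 [Ac1 Ab1 LL1 ev1 eS]]]]]].
move=> [n2 [c2 [b2 [L2 [v2 [Ac2 Ab2 LL2 ev2 eT]]]]]].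
exists (n1 + n2)%N, (row_mx c1 c2), (col_mx b1 b2), (block_mx L1 0 0 L2).
exists (col_mx v1 v2); split.
- exact: mx_all_row.
- exact: mx_all_col.
- by apply: mx_all_block => //; apply: linear_mx0.
- rewrite map_col_mx mul_block_col add_col_mx !mul0mx addr0 add0r.
  by rewrite -ev1 -ev2.
- by rewrite map_row_mx mul_row_col -eS -eT raddfD.
Qed.

(** If [v1] solves the system of [S], then [v1 T] solves
    [v = b1 c2 v2 + L1 v], whose coefficient [b1 c2] is not linear. Its
    linear part [L1 v1 T] is therefore taken as the unknown: it satisfies
    [u = L1 (u + b1 c2 v2)], and [L1 b1 c2] is linear. *)
Lemma realizableM S T : realizable S -> realizable T -> realizable (S * T).
Proof.
move=> [n1 [c1 [b1 [L1 [v1 [Ac1 Ab1 LL1 ev1 eS]]]]]].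
move=> [n2 [c2 [b2 [L2 [v2 [Ac2 Ab2 LL2 ev2 eT]]]]]].
have [u Eu] : exists u, L1 *m v1 *m T%:M = u by exists (L1 *m v1 *m T%:M).
have eu : v1 *m T%:M = u + b1^cst *m c2^cst *m v2.
  by rewrite {1}ev1 mulmxDl Eu eT [LHS]addrC [in LHS]mulmxA.
exists (n1 + n2)%N, (row_mx c1 (c1 *m (b1 *m c2))), (col_mx 0 b2).
exists (block_mx L1 (L1 *m (b1 *m c2)^cst) 0 L2), (col_mx u v2); split.
- by apply: mx_all_row => //; do 2?apply: const_inM.
- by apply: mx_all_col => //; apply: const_in0.
- apply: mx_all_block => //; last exact: linear_mx0.
  by apply: linear_mxM => //; apply: const_inM.
- rewrite map_col_mx map_mx0 mul_block_col add_col_mx mul0mx !add0r -ev2.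
  congr col_mx; rewrite map_mxM -[L1 *m _ *m v2]mulmxA -mulmxDr -eu.
  by rewrite mulmxA Eu.
- rewrite scalar_mxM eS map_row_mx mul_row_col -mulmxA eu mulmxDr.
  by rewrite !map_mxM !mulmxA.
Qed.

(** Setting all the [x_j] to 0 kills [L]. *)
Lemma coef_realization n (c : 'rV_n) (b : 'cV_n) (L : 'M_n) (v : 'cV_n)
    (S : ser) :
  linear_mx L -> v = b^cst + L *m v -> S%:M = c^cst *m v ->
  (coef S [::])%:M = c *m b.
Proof.
move=> LL ev eS; apply/matrixP => i j; rewrite !ord1.
have -> : ((coef S [::])%:M : 'M['M[F]_m.+1]_1) 0 0
    = coef ((S%:M : 'M_1) 0 0) [::].
  by rewrite !mxE eqxx !mulr1n.
rewrite eS coef_mulmx_nil mxE; apply: eq_bigr => k _; rewrite mxE.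
congr (_ * _); rewrite ev mxE coefD mxE coef_mulmx_nil big1 ?addr0 // => l _.
by rewrite linear_series_coef_nil ?mul0r.
Qed.

(** With [v] the solution for [S] and [s] the constant term of [S], the vector
    [u := L v S^-1] satisfies [v S^-1 = b s^-1 + (1 - b s^-1 c) u] and
    [S^-1 = s^-1 - s^-1 c u]: one multiplies [S = s + c L v] by the inverses.
    Applying [L] to the first identity gives a linear system for [u], with
    inhomogeneous part [L b s^-1]; a last unknown, equal to 1, turns the latter
    into a coefficient. As [A] has finite dimension, it contains [s^-1]. *)
Lemma realizableV S : S \is a GRing.unit -> realizable S -> realizable S^-1.
Proof.
move=> uS [n [c [b [L [v [Ac Ab LL ev eS]]]]]].
have ecb := coef_realization LL ev eS.
set s := coef S [::] in ecb.
have us : s \is a GRing.unit by rewrite -ncseries_unitE.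
have As : s^-1 \in A.
  rewrite memvV; have := const_inM Ac Ab.
  by rewrite -ecb => /(_ 0 0); rewrite mxE.
have [u eu] : exists u, L *m v *m (S^-1)%:M = u.
  by exists (L *m v *m (S^-1)%:M).
have Ad : const_in (b *m (s^-1)%:M).
  by apply: const_inM => //; apply: const_in_scalar.
(* S S^-1 = 1, where S = s + c L v, solved for S^-1 *)
have ey : (S^-1)%:M = ((s^-1)%:M)^cst - ((s^-1)%:M *m c)^cst *m u.
  have : 1%:M = ((s%:M)^cst *m (S^-1)%:M + c^cst *m u : 'M_1).
    rewrite -(divrr uS) scalar_mxM eS {1}ev mulmxDr mulmxDl -map_mxM -ecb.
    by rewrite -eu !mulmxA.
  move/(congr1 (mulmx (((s^-1)%:M)^cst))); rewrite mulmx1 mulmxDr.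
  rewrite mulmxA -map_mxM.
  rewrite -scalar_mxM mulVr // map_scalar_mx rmorph1 mul1mx => ->.
  by rewrite map_mxM !mulmxA addrK.
have ew : v *m (S^-1)%:M =
    (1%:M - b *m (s^-1)%:M *m c)^cst *m u + (b *m (s^-1)%:M)^cst.
  rewrite {1}ev mulmxDl eu {1}ey mulmxBr -map_mxM mulmxA -map_mxM.
  rewrite map_mxB mulmxBl map_scalar_mx rmorph1 mul1mx !mulmxA.
  by rewrite addrC addrA addrAC.
exists (n + 1)%N, (row_mx (- ((s^-1)%:M *m c)) (s^-1)%:M), (col_mx 0 1%:M).
exists (block_mx (L *m (1%:M - b *m (s^-1)%:M *m c)^cst)
                 (L *m (b *m (s^-1)%:M)^cst) 0 0), (col_mx u 1%:M); split.
- apply: mx_all_row; last exact: const_in_scalar.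
  by apply: const_inN; apply: const_inM => //; apply: const_in_scalar.
- by apply: mx_all_col; [apply: const_in0 | apply: const_in_scalar].
- apply: mx_all_block; try exact: linear_mx0; apply: linear_mxM => //.
  by apply: const_inB; [apply: const_in_scalar | apply: const_inM].
- rewrite map_col_mx map_mx0 map_scalar_mx rmorph1 mul_block_col add_col_mx.
  rewrite !mul0mx !add0r mulmx1 addr0; congr col_mx.
  by rewrite -[L *m _ *m u]mulmxA -mulmxDr -ew mulmxA eu.
- by rewrite map_row_mx mul_row_col mulmx1 map_mxN mulNmx addrC -ey.
Qed.

Lemma realizable_eval (a : 'I_g -> ser) (r : ratexpr F g) :
  (forall j, realizable (a j)) -> rat_defined a r -> realizable (rat_eval a r).
Proof.
move=> ra; elim: r => [P|r1 IH1 r2 IH2|r1 IH1 r2 IH2|r1 IH1] /=.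
- move=> _; rewrite /poly_eval mmapE.
  have r0 : realizable 0.
    by rewrite -(rmorph0 ncconst); apply: realizable_const; apply: mem0v.
  elim/big_ind: _ => // [|w _]; first exact: realizableD.
  apply: realizableM.
    rewrite /= -(rmorph1 ncconst) -linearZ; apply: realizable_const.
    exact: memvZ.
  elim/big_ind: _ => // [|]; last exact: realizableM.
  by rewrite -(rmorph1 ncconst); apply: realizable_const.
- by move=> /andP[/IH1 ? /IH2]; apply: realizableD.
- by move=> /andP[/IH1 ? /IH2]; apply: realizableM.
- by move=> /andP[/IH1 ? ?]; apply: realizableV.
Qed.

(** Each entry of [L] is a sum of one linear series per variable; choosing such
    a decomposition for every entry writes [L] as the sum of the [L j]. *)
Lemma realizableP S : realizable S ->
  exists (n : nat) (c : 'rV['M[F]_m.+1]_n) (b : 'cV['M[F]_m.+1]_n)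
         (L : 'I_g -> 'M[ser]_n) (N : 'M[ser]_n),
    [/\ forall i, c 0 i \in A,
        forall i, b i 0 \in A,
        forall j i k, in_bimodule A j (L j i k),
        mx_inverse (1%:M - \sum_(j < g) L j) N
      & S%:M = c^cst *m N *m b^cst].
Proof.
move=> [n [c [b [L [v [Ac Ab LL ev ->]]]]]].
pose f i k := s2val (cid2 (LL i k)).
have fP i k : forall j, in_bimodule A j (f i k j) := s2valP (cid2 (LL i k)).
have eL : L = \sum_j \matrix_(i, k) f i k j.
  apply/matrixP => i k; rewrite summxE (s2valP' (cid2 (LL i k))).
  by apply: eq_bigr => j _; rewrite mxE.
have [N invN] : exists N, mx_inverse (1%:M - L) N.
  by apply: mx_inverse_1sub => i j; apply: linear_series_coef_nil.
exists n, c, b, (fun j => \matrix_(i, k) f i k j), N.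
split; [by move=> i; apply: Ac | by move=> i; apply: Ab | | |].
- by move=> j i k; rewrite mxE.
- by rewrite -eL.
- rewrite -mulmxA; congr (_ *m _); case: invN => _ NK.
  by rewrite -[v]mul1mx -NK -mulmxA mulmxBl mul1mx {1}ev addrK.
Qed.
End Realization.

(** * The realization of an expansion *)

Theorem corollary5p1 (F : fieldType) (charF0 : [pchar F] =i pred0) (g m : nat)
    (r : ratexpr F g) (p : 'I_g -> 'M[F]_m.+1) (p_dom : p \in rat_dom r) :
  exists (n : nat) (c : 'rV['M[F]_m.+1]_n) (b : 'cV['M[F]_m.+1]_n)
         (A : 'I_g -> 'M[gseries F g m]_n) (N : 'M[gseries F g m]_n),
    [/\ forall i, c 0 i \in gen_alg p,
        forall i, b i 0 \in gen_alg p,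
        forall j i k, in_bimodule (gen_alg p) j (A j i k),
        mx_inverse (1%:M - \sum_(j < g) A j) N
      & (rat_expansion r p)%:M = map_mx ncconst c *m N *m map_mx ncconst b].
Proof.
pose A : {aspace 'M[F]_m.+1} := agenv_aspace (1 + <<codom p>>)%VS.
have A1 : 1 \in A by apply: (subvP (sub1_agenv _)); apply: memv_line.
have Ap j : p j \in A.
  apply: (subvP (sub_agenv _)); apply: (subvP (addvSr _ _)).
  by apply: memv_span; apply: codom_f.
have [def_r _] := rat_expansion_defined p_dom.
apply: (@realizableP F g m A); apply: realizable_eval => // j.
apply: realizableD; last exact: realizable_const.
exact: realizable_linear (linear_series_var A1 j).
Qed.
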